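(* Let $A$ be an associative algebra over $\mathbb F$, let $M$ be an $A$-$A$-bimodule, and let $c\in HH^3(A,M)$. Then there exist an associative algebra $K$ containing $M$ as a subspace with $\mathrm{Anni}K=M$, and a coupling $\xi:A\to\mathrm{Out}(K)$ admitting a bimultiplication law $\mu=(u,v)$ covering $\xi$, such that: (1) $a\mapsto u_a$ is an algebra homomorphism $A\to\mathrm{End}_{\mathbb F}(K)$ (so $K$ is a left $A$-module); (2) the $A$-bimodule structure induced by $\xi$ on $\mathrm{Anni}K=M$ coincides with the given bimodule structure of $M$; (3) $\mathrm{Obs}(\xi)=c$.
   Context: All algebras are associative, not necessarily unital, over a field $\mathbb F$. For an algebra $K$, a bimultiplication of $K$ is a pair $(u,v)$ of linear maps $K\to K$ with $k_1u(k_2)=v(k_1)k_2$, $u(k_1k_2)=u(k_1)k_2$, $v(k_1k_2)=k_1v(k_2)$; these form an algebra $\mathrm{Mul}(K)$ with product $(u_1,v_1)(u_2,v_2)=(u_1\circ u_2,\ v_2\circ v_1)$. $\epsilon:K\to\mathrm{Mul}(K)$, $\epsilon(k_0)=(k\mapsto k_0k,\ k\mapsto kk_0)$; $\mathrm{Inn}(K)=\epsilon(K)$, $\mathrm{Out}(K)=\mathrm{Mul}(K)/\mathrm{Inn}(K)$ with projection $\natural$; $\mathrm{Anni}K=\{k: kK=0=Kk\}$. A coupling is an algebra homomorphism $\xi:A\to\mathrm{Out}(K)$. A bimultiplication law covering $\xi$ is a linear map $\mu:A\to\mathrm{Mul}(K)$, $\mu(a)=(u_a,v_a)$, with $\natural\circ\mu=\xi$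 and $u_av_b=v_bu_a$ for all $a,b\in A$; then $\mathrm{Anni}K$ is an $A$-bimodule via $a\cdot n=u_a(n)$, $n\cdot a=v_a(n)$, independent of $\mu$. Curvature $R^\mu(a_1,a_2)=\mu(a_1)\mu(a_2)-\mu(a_1a_2)\in\mathrm{Inn}(K)$; a hindrance is a bilinear $h:A\times A\to K$ with $\epsilon\circ h=R^\mu$; $f(\mu,h)(a_1,a_2,a_3)=u_{a_1}h(a_2,a_3)-h(a_1a_2,a_3)+h(a_1,a_2a_3)-v_{a_3}h(a_1,a_2)$ is a Hochschild 3-cocycle of $A$ with values in $\mathrm{Anni}K$, and its class $\mathrm{Obs}(\xi)\in HH^3(A,\mathrm{Anni}K)$ is independent of $\mu$ and $h$. *)

(* Defs.v *)
From HB Require Import structures.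
From mathcomp Require Import all_boot all_order all_algebra.
Set Implicit Arguments. Unset Strict Implicit. Unset Printing Implicit Defensive.
Import GRing.Theory.
Local Open Scope ring_scope.

Definition lin (F : fieldType) (U V : lmodType F) (f : U -> V) : Prop :=
  forall (r : F) x y, f (r *: x + y) = r *: f x + f y.

Record nualg (F : fieldType) := NUAlg {
  nua_car :> lmodType F;
  nua_mul : nua_car -> nua_car -> nua_car;
  nua_mulA : forall x y z, nua_mul x (nua_mul y z) = nua_mul (nua_mul x y) z;
  nua_mulDl : forall x y z, nua_mul (x + y) z = nua_mul x z + nua_mul y z;
  nua_mulDr : forall x y z, nua_mul x (y + z) = nua_mul x y + nua_mul x z;
  nua_mulZl : forall (r : F) x y, nua_mul (r *: x) y = r *: nua_mul x y;
  nua_mulZr : forall (r : F) x y, nua_mul x (r *: y) = r *: nua_mul x y }.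
Arguments nua_mul {F} n x y.
Notation "x *n y" := (nua_mul _ x y) (at level 40, left associativity).

Record bimod (F : fieldType) (A : nualg F) := BiMod {
  bm_car :> lmodType F;
  bm_l : A -> bm_car -> bm_car;
  bm_r : bm_car -> A -> bm_car;
  bm_l_linA : forall m, lin (fun a : A => bm_l a m);
  bm_l_linM : forall a, lin (bm_l a);
  bm_r_linA : forall m, lin (bm_r m);
  bm_r_linM : forall a, lin (fun m : bm_car => bm_r m a);
  bm_lA : forall a b m, bm_l (a *n b) m = bm_l a (bm_l b m);
  bm_rA : forall a b m, bm_r m (a *n b) = bm_r (bm_r m a) b;
  bm_lrA : forall a b m, bm_r (bm_l a m) b = bm_l a (bm_r m b) }.
Arguments bm_l {F A} _ _ _.
Arguments bm_r {F A} _ _ _.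

Section Hochschild.
Variables (F : fieldType) (A : nualg F) (M : bimod A).

Definition bilin (V : lmodType F) (g : A -> A -> V) : Prop :=
  (forall a, lin (g a)) /\ (forall b, lin (fun a => g a b)).

Definition trilin (V : lmodType F) (c : A -> A -> A -> V) : Prop :=
  (forall a b, lin (c a b)) /\ (forall a c', lin (fun b => c a b c'))
  /\ (forall b c', lin (fun a => c a b c')).

Definition hoch_d2 (g : A -> A -> M) (a1 a2 a3 : A) : M :=
  bm_l M a1 (g a2 a3) - g (a1 *n a2) a3 + g a1 (a2 *n a3) - bm_r M (g a1 a2) a3.

Definition hoch_d3 (c : A -> A -> A -> M) (a1 a2 a3 a4 : A) : M :=
  bm_l M a1 (c a2 a3 a4) - c (a1 *n a2) a3 a4 + c a1 (a2 *n a3) a4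
  - c a1 a2 (a3 *n a4) + bm_r M (c a1 a2 a3) a4.

(* Hochschild 3-cocycles: representatives of classes in HH^3(A,M) *)
Definition is_3cocycle (c : A -> A -> A -> M) : Prop :=
  trilin c /\ forall a1 a2 a3 a4, hoch_d3 c a1 a2 a3 a4 = 0.
End Hochschild.

Section Bimult.
Variables (F : fieldType) (K : nualg F).

Definition bimul := ((K -> K) * (K -> K))%type.

Definition is_bimul (m : bimul) : Prop :=
  lin m.1 /\ lin m.2 /\
  forall k1 k2, k1 *n m.1 k2 = m.2 k1 *n k2 /\
                m.1 (k1 *n k2) = m.1 k1 *n k2 /\
                m.2 (k1 *n k2) = k1 *n m.2 k2.

Definition bimul_mul (m1 m2 : bimul) : bimul := (m1.1 \o m2.1, m2.2 \o m1.2).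
Definition bimul_add (m1 m2 : bimul) : bimul :=
  (fun k => m1.1 k + m2.1 k, fun k => m1.2 k + m2.2 k).
Definition bimul_scale (r : F) (m : bimul) : bimul :=
  (fun k => r *: m.1 k, fun k => r *: m.2 k).
Definition bimul_sub (m1 m2 : bimul) : bimul :=
  (fun k => m1.1 k - m2.1 k, fun k => m1.2 k - m2.2 k).

Definition eps (k0 : K) : bimul := (fun k => k0 *n k, fun k => k *n k0).
Definition is_inn (m : bimul) : Prop := exists k0, forall k, m.1 k = (eps k0).1 k /\ m.2 k = (eps k0).2 k.

Definition anni (k : K) : Prop := forall x, k *n x = 0 /\ x *n k = 0.

(* Out(K) = Mul(K)/Inn(K): elements are cosets, i.e. predicates on bimul *)
Definition out := bimul -> Prop.
Definition natural (m : bimul) : out :=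
  fun m' => is_bimul m' /\ is_inn (bimul_sub m' m).

(* coupling: algebra homomorphism A -> Out(K) (quotient operations via representatives) *)
Definition is_coupling (A : nualg F) (xi : A -> out) : Prop :=
  (forall a, exists m, is_bimul m /\ xi a = natural m) /\
  (forall a b m1 m2, is_bimul m1 -> is_bimul m2 ->
     xi a = natural m1 -> xi b = natural m2 ->
     xi (a *n b) = natural (bimul_mul m1 m2) /\
     xi (a + b) = natural (bimul_add m1 m2) /\
     forall r : F, xi (r *: a) = natural (bimul_scale r m1)).

Definition is_bimul_law (A : nualg F) (xi : A -> out) (mu : A -> bimul) : Prop :=
  (forall a, is_bimul (mu a)) /\
  (forall (r : F) a b k, (mu (r *: a + b)).1 k = r *: (mu a).1 k + (mu b).1 k /\
                         (mu (r *: a + b)).2 k = r *: (mu a).2 k + (mu b).2 k) /\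
  (forall a, xi a = natural (mu a)) /\
  (forall a b k, (mu a).1 ((mu b).2 k) = (mu b).2 ((mu a).1 k)).

Definition is_hindrance (A : nualg F) (mu : A -> bimul) (h : A -> A -> K) : Prop :=
  bilin h /\
  forall a1 a2 k,
    (bimul_mul (mu a1) (mu a2)).1 k - (mu (a1 *n a2)).1 k = (eps (h a1 a2)).1 k /\
    (bimul_mul (mu a1) (mu a2)).2 k - (mu (a1 *n a2)).2 k = (eps (h a1 a2)).2 k.

Definition obs_cocycle (A : nualg F) (mu : A -> bimul) (h : A -> A -> K) (a1 a2 a3 : A) : K :=
  (mu a1).1 (h a2 a3) - h (a1 *n a2) a3 + h a1 (a2 *n a3) - (mu a3).2 (h a1 a2).
End Bimult.

(* Main.v *)
(** Let W = Hom(A, M) with (a f)(x) = a f(x) and (f a)(x) = f(ax) - f(a)x. The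
    coinduced bimodule N = Hom(A^+, M) is an extension of W by M in which c becomes
    the coboundary of h(a, b) = (0, - c(a, b, _)); the image of h in W is therefore a
    2-cocycle and defines a square-zero extension E of A by W. Let
    T = E^+ = F + A + W, with its right multiplications by elements of A (which compose
    up to h) and of N (through W), and put K = N + F e + T, where e is a left identity
    of F e + T, and all other products vanish except T N. Left multiplication by e
    kills no element of F e + T and the unit of T kills no element of W, so that the
    annihilator of K is M. Let A act on K on the left through N only, and on the right
    through N and T: these actions compose up to inner bimultiplication by h, whose
    obstruction cocycle is c. Another law differs from this one by inner
    bimultiplications, which can be chosen linearly because M has a complement in K,
    and this changes the obstruction cocycle by a coboundary. *)
Require Import Defs.
From HB Require Import structures.
From mathcomp Require Import all_boot all_order all_algebra.
From mathcomp Require Import boolp functions.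
Set Implicit Arguments. Unset Strict Implicit. Unset Printing Implicit Defensive.
Import GRing.Theory.
Local Open Scope ring_scope.

(* Reflexive decision procedure for identities in abelian groups. *)
Inductive zexpr := ZVar of nat | ZZero | ZAdd of zexpr & zexpr | ZOpp of zexpr.

Fixpoint zeval (V : zmodType) (env : seq V) (e : zexpr) : V :=
  match e with
  | ZVar i => nth 0 env i
  | ZZero => 0
  | ZAdd e1 e2 => zeval env e1 + zeval env e2
  | ZOpp e1 => - zeval env e1
  end.

Fixpoint zcoef (e : zexpr) (i : nat) : int :=
  match e with
  | ZVar j => if i == j then 1 else 0
  | ZZero => 0
  | ZAdd e1 e2 => zcoef e1 i + zcoef e2 i
  | ZOpp e1 => - zcoef e1 i
  end.

Lemma zeval_sum (V : zmodType) (env : seq V) e :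
  zeval env e = \sum_(i < size env) nth 0 env i *~ zcoef e i.
Proof.
elim: e => [j||e1 IH1 e2 IH2|e1 IH1] /=.
- have [lt_j|le_j] := ltnP j (size env).
    rewrite (bigD1 (Ordinal lt_j)) //= eqxx big1 ?addr0 // => i.
    by rewrite -val_eqE /= => /negPf->.
  (* An index outside the environment evaluates to the default 0, and no summand has a nonzero
     coefficient for it. *)
  rewrite nth_default // big1 // => i _.
  by case: eqP le_j => // <-; rewrite leqNgt ltn_ord.
- by rewrite big1.
- by rewrite IH1 IH2 -big_split; apply: eq_bigr => i _; rewrite mulrzDr.
- by rewrite IH1 -sumrN; apply: eq_bigr => i _; rewrite mulrNz.
Qed.

Lemma zeval_eq (V : zmodType) (env : seq V) e1 e2 :
  all (fun i => zcoef e1 i == zcoef e2 i) (iota 0 (size env)) ->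
  zeval env e1 = zeval env e2.
Proof.
move=> /allP eq_coef; rewrite !zeval_sum; apply: eq_bigr => i _.
by rewrite (eqP (eq_coef i _)) // mem_iota ltn_ord.
Qed.

(* Atoms are compared up to conversion, as equal terms may carry different structure instances. *)
Ltac zindex x env :=
  match env with
  | ?y :: _ => let _ := match goal with _ => unify x y end in constr:(0%N)
  | _ :: ?env' => let n := zindex x env' in constr:(S n)
  end.

Ltac zmem x env :=
  match env with
  | nil => constr:(false)
  | ?y :: _ => let _ := match goal with _ => unify x y end in constr:(true)
  | _ :: ?env' => zmem x env'
  end.

Ltac zatoms e env :=
  lazymatch e with
  | ?x + ?y => let env' := zatoms x env in zatoms y env'
  | - ?x => zatoms x env
  | 0 => env
  | ?x => lazymatch zmem x env with true => env | false => constr:(x :: env) end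
  end.

Ltac zreify e env :=
  lazymatch e with
  | ?x + ?y => let r := zreify x env in let s := zreify y env in constr:(ZAdd r s)
  | - ?x => let r := zreify x env in constr:(ZOpp r)
  | 0 => constr:(ZZero)
  | ?x => let n := zindex x env in constr:(ZVar n)
  end.

Ltac zmod :=
  lazymatch goal with
  | |- @eq ?V ?x ?y =>
    let env := zatoms x (@nil V) in
    let env := zatoms y env in
    let r := zreify x env in
    let s := zreify y env in
    exact: (@zeval_eq _ env r s)
  end.

(** * Consequences of linearity *)

Section Lin.
Context {F : fieldType} {U V : lmodType F} {f : U -> V} (f_lin : lin f).

Lemma linD x y : f (x + y) = f x + f y.
Proof. by have := f_lin 1 x y; rewrite !scale1r. Qed.

Lemma lin0 : f 0 = 0.
Proof. by apply: (addrI (f 0)); rewrite -linD !addr0. Qed.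

Lemma linZ r x : f (r *: x) = r *: f x.
Proof. by have := f_lin r x 0; rewrite lin0 !addr0. Qed.

Lemma linN x : f (- x) = - f x.
Proof. by rewrite -!scaleN1r linZ. Qed.

Lemma linB x y : f (x - y) = f x - f y.
Proof. by rewrite linD linN. Qed.

End Lin.

Section NualgLin.
Context {F : fieldType} (K : nualg F).

Lemma lin_mulr (x : K) : lin (nua_mul K x).
Proof. by move=> r y z; rewrite nua_mulDr nua_mulZr. Qed.

Lemma lin_mull (y : K) : lin (fun x : K => x *n y).
Proof. by move=> r x z; rewrite nua_mulDl nua_mulZl. Qed.

End NualgLin.

(** * Bimultiplications modulo inner ones, and the coupling defined by a law *)

Section Coupling.
Context {F : fieldType} {K : nualg F}.

Lemma bimul_lin1 (m : bimul K) : is_bimul m -> lin m.1.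
Proof. by case. Qed.

Lemma bimul_lin2 (m : bimul K) : is_bimul m -> lin m.2.
Proof. by case=> _ []. Qed.

Lemma bimulE (m : bimul K) k1 k2 : is_bimul m -> k1 *n m.1 k2 = m.2 k1 *n k2.
Proof. by case=> _ [_ /(_ k1 k2) [? []]]. Qed.

Lemma bimul1M (m : bimul K) k1 k2 : is_bimul m -> m.1 (k1 *n k2) = m.1 k1 *n k2.
Proof. by case=> _ [_ /(_ k1 k2) [? []]]. Qed.

Lemma bimul2M (m : bimul K) k1 k2 : is_bimul m -> m.2 (k1 *n k2) = k1 *n m.2 k2.
Proof. by case=> _ [_ /(_ k1 k2) [? []]]. Qed.

Definition perturbs (m m' : bimul K) (k : K) : Prop :=
  forall x, m'.1 x = m.1 x + k *n x /\ m'.2 x = m.2 x + x *n k.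

Lemma perturbsP m m' : is_inn (bimul_sub m' m) <-> exists k, perturbs m m' k.
Proof.
split=> -[k km]; exists k => x; have /= [km1 km2] := km x.
  by rewrite -km1 -km2; split; zmod.
by rewrite /= km1 km2; split; zmod.
Qed.

(** Inn(K) is a two-sided ideal: [m1] composed with [eps k2] is [eps (m1.1 k2)], and [eps k1]
    composed with [m2] is [eps (m2.2 k1)]. *)
Lemma perturbs_mul m1 m2 n1 n2 k1 k2 :
  is_bimul m1 -> is_bimul m2 -> perturbs m1 n1 k1 -> perturbs m2 n2 k2 ->
  perturbs (bimul_mul m1 m2) (bimul_mul n1 n2) (m1.1 k2 + m2.2 k1 + k1 *n k2).
Proof.
move=> bm1 bm2 mn1 mn2 x; split => /=.
  rewrite (mn1 _).1 (mn2 x).1 (linD (bimul_lin1 bm1)) !nua_mulDr !nua_mulDl.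
  rewrite (bimul1M _ _ bm1) (bimulE _ _ bm2) nua_mulA; zmod.
rewrite (mn2 _).2 (mn1 x).2 (linD (bimul_lin2 bm2)) !nua_mulDr !nua_mulDl.
rewrite (bimul2M _ _ bm2) -(bimulE _ _ bm1) nua_mulA; zmod.
Qed.

Lemma natural_perturbs m m' k : perturbs m m' k -> natural m = natural m'.
Proof.
move=> mm'; apply/funext => n; apply/propext; split=> -[bn /perturbsP[l nl]];
  split=> //; apply/perturbsP.
  exists (l - k) => x; rewrite (nl x).1 (nl x).2 (mm' x).1 (mm' x).2.
  by rewrite (linB (lin_mulr x)) (linB (lin_mull x)); split; zmod.
exists (l + k) => x; rewrite (nl x).1 (nl x).2 (mm' x).1 (mm' x).2.
by rewrite nua_mulDl nua_mulDr; split; zmod.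
Qed.

(** Cosets are predicates, so their equality is evaluated at [m'], which lies in its own coset with
    inner part 0. *)
Lemma perturbs_natural m m' :
  is_bimul m' -> natural m = natural m' -> exists k, perturbs m m' k.
Proof.
move=> bm' nmm'; apply/perturbsP; suff [] : natural m m' by [].
rewrite nmm'; split=> //; apply/perturbsP; exists 0 => x.
by rewrite (lin0 (lin_mulr x)) (lin0 (lin_mull x)) !addr0.
Qed.

Lemma coupling_natural (A : nualg F) (mu : A -> bimul K) (h : A -> A -> K) :
  (forall a, is_bimul (mu a)) ->
  (forall (r : F) a b k, (mu (r *: a + b)).1 k = r *: (mu a).1 k + (mu b).1 k /\
                         (mu (r *: a + b)).2 k = r *: (mu a).2 k + (mu b).2 k) ->
  is_hindrance mu h -> is_coupling (fun a => natural (mu a)).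
Proof.
move=> bmu lmu [_ hE]; split=> [a|a b m1 m2 bm1 bm2]; first by exists (mu a).
move=> /(perturbs_natural bm1)[k mk] /(perturbs_natural bm2)[l ml].
have lmu1 x : lin (fun a => (mu a).1 x) by move=> r a' b'; rewrite (lmu _ _ _ _).1.
have lmu2 x : lin (fun a => (mu a).2 x) by move=> r a' b'; rewrite (lmu _ _ _ _).2.
split; [|split=> [|r]].
- have pm := perturbs_mul (bmu a) (bmu b) mk ml.
  (* The term [h a b] accounts for the curvature, the others for the change of representatives. *)
  apply: natural_perturbs (h a b + ((mu a).1 l + (mu b).2 k + k *n l)) _ => x.
  rewrite (pm x).1 (pm x).2; have /= [hE1 hE2] := hE a b x.
  by rewrite (nua_mulDl (h a b)) (nua_mulDr x (h a b)) -hE1 -hE2; split; zmod.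
- apply: natural_perturbs (k + l) _ => x /=.
  rewrite (linD (lmu1 x)) (linD (lmu2 x)) (mk x).1 (mk x).2 (ml x).1 (ml x).2.
  by rewrite nua_mulDl nua_mulDr; split; zmod.
- apply: natural_perturbs (r *: k) _ => x /=.
  rewrite (linZ (lmu1 x)) (linZ (lmu2 x)) (mk x).1 (mk x).2.
  by rewrite nua_mulZl nua_mulZr !scalerDr.
Qed.

End Coupling.

(** * Independence of the obstruction class from the law and the hindrance *)

Section ObstructionClass.
Context {F : fieldType} {A K : nualg F} {M : bimod A}.
Variables (iota : M -> K) (proj : K -> M).
Hypotheses (iota_lin : lin iota) (proj_lin : lin proj).
Hypothesis projK : cancel iota proj.
Hypothesis anniP : forall k, anni k <-> exists m, k = iota m.

Variables (mu : A -> bimul K) (h : A -> A -> K).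
Hypothesis mu_bimul : forall a, is_bimul (mu a).
Hypothesis mu_lin : forall (r : F) a b k,
  (mu (r *: a + b)).1 k = r *: (mu a).1 k + (mu b).1 k /\
  (mu (r *: a + b)).2 k = r *: (mu a).2 k + (mu b).2 k.
Hypothesis mu_comm : forall a b k, (mu a).1 ((mu b).2 k) = (mu b).2 ((mu a).1 k).
Hypothesis mu_iota : forall a m,
  (mu a).1 (iota m) = iota (bm_l M a m) /\ (mu a).2 (iota m) = iota (bm_r M m a).
Hypothesis h_hindrance : is_hindrance mu h.

Lemma mul_iotal m k : iota m *n k = 0.
Proof. by have /anniP/(_ k)[] : exists m', iota m = iota m' by exists m. Qed.

Lemma mul_iotar m k : k *n iota m = 0.
Proof. by have /anniP/(_ k)[] : exists m', iota m = iota m' by exists m. Qed.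

(** The difference of [k] and [k'] lies in Anni K, the image of [iota], and the projection along
    [iota] kills that image. *)
Lemma eq_mod_anni k k' :
  (forall x, k *n x = k' *n x /\ x *n k = x *n k') -> k - iota (proj k) = k' - iota (proj k').
Proof.
move=> kk'; have [x|m kE] := (anniP (k - k')).1.
  rewrite (linB (lin_mulr x)) (linB (lin_mull x)).
  by rewrite (kk' x).1 (kk' x).2 !subrr.
have -> : k = k' + iota m by rewrite -kE; zmod.
rewrite (linD proj_lin) (linD iota_lin) projK; zmod.
Qed.

(* The choice of the inner correction becomes linear once its M-component is removed. *)
Lemma law_perturbs mu' : is_bimul_law (fun a => natural (mu a)) mu' ->
  exists2 l : A -> K, lin l & forall a, perturbs (mu a) (mu' a) (l a).
Proof.
move=> [bmu' [lmu' [nat_mu' _]]].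
have /choice[l0 l0P] a : exists k, perturbs (mu a) (mu' a) k.
  exact: perturbs_natural (bmu' a) (nat_mu' a).
exists (fun a => l0 a - iota (proj (l0 a))) => [r a b|a x]; last first.
  rewrite (linB (lin_mulr x)) (linB (lin_mull x)) mul_iotal mul_iotar !subr0.
  exact: l0P.
have -> : r *: (l0 a - iota (proj (l0 a))) + (l0 b - iota (proj (l0 b))) =
    (r *: l0 a + l0 b) - iota (proj (r *: l0 a + l0 b)).
  by rewrite proj_lin iota_lin scalerBr; zmod.
(* Both elements induce the same inner bimultiplication: the difference of [mu'] and [mu] at
   [r *: a + b]. *)
apply: eq_mod_anni => x.
rewrite nua_mulDl nua_mulDr nua_mulZl nua_mulZr.
have [p1 p2] := l0P (r *: a + b) x; have [q1 q2] := l0P a x.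
have [s1 s2] := l0P b x; have [t1 t2] := lmu' r a b x; have [w1 w2] := mu_lin r a b x.
split.
  apply: (addrI ((mu (r *: a + b)).1 x)).
  by rewrite -p1 t1 w1 q1 s1 scalerDr; zmod.
apply: (addrI ((mu (r *: a + b)).2 x)).
by rewrite -p2 t2 w2 q2 s2 scalerDr; zmod.
Qed.

Lemma law_iota mu' : is_bimul_law (fun a => natural (mu a)) mu' -> forall a m,
  (mu' a).1 (iota m) = iota (bm_l M a m) /\ (mu' a).2 (iota m) = iota (bm_r M m a).
Proof.
move=> /law_perturbs[l _ mul] a m; have [-> ->] := mul a (iota m).
by rewrite mul_iotal mul_iotar !addr0; exact: mu_iota.
Qed.

(** Transporting [h] along the perturbation [l] gives a hindrance [h0] of [mu'] with the same
    obstruction cocycle. Two hindrances of [mu'] differ by a cochain [g] with values in the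
    annihilator, which contributes its coboundary. *)
Lemma obs_cocycle_law mu' h' :
  is_bimul_law (fun a => natural (mu a)) mu' -> is_hindrance mu' h' ->
  exists2 g : A -> A -> M, bilin g &
    forall a1 a2 a3, obs_cocycle mu' h' a1 a2 a3 =
                     obs_cocycle mu h a1 a2 a3 + iota (hoch_d2 g a1 a2 a3).
Proof.
move=> law' [[h'_linr h'_linl] h'E].
have [l l_lin mul] := law_perturbs law'.
have [[h_linr h_linl] hE] := h_hindrance.
(* Obtained by expanding the curvature of [mu] + [eps] [l], with the product computed as in
   [perturbs_mul]. *)
pose h0 a b := h a b + ((mu a).1 (l b) + (mu b).2 (l a) + l a *n l b) - l (a *n b).
have h0_linr a : lin (h0 a).
  move=> r x y; rewrite /h0 (lin_mulr a) !l_lin h_linr (bimul_lin1 (mu_bimul a)).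
  by rewrite (mu_lin _ _ _ _).2 (lin_mulr (l a)) !(scalerDr, scalerN); zmod.
have h0_linl b : lin (h0^~ b).
  move=> r x y; rewrite /h0 (lin_mull b) !l_lin h_linl (bimul_lin2 (mu_bimul b)).
  by rewrite (mu_lin _ _ _ _).1 (lin_mull (l b)) !(scalerDr, scalerN); zmod.
pose g a b := proj (h' a b - h0 a b).
have gE a b : h' a b = h0 a b + iota (g a b).
  suff /anniP[m hm] : anni (h' a b - h0 a b) by rewrite /g hm projK -hm; zmod.
  move=> x; have [/= h1 h2] := hE a b x; have [/= h1' h2'] := h'E a b x.
  have [/= p1 p2] := perturbs_mul (mu_bimul a) (mu_bimul b) (mul a) (mul b) x.
  have [q1 q2] := mul (a *n b) x.
  rewrite (linB (lin_mulr x)) (linB (lin_mull x)) -[h' a b *n x]h1' -[x *n h' a b]h2'.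
  rewrite p1 p2 q1 q2 /h0 (linB (lin_mulr x)) (linB (lin_mull x)).
  rewrite (nua_mulDl (h a b)) (nua_mulDr x (h a b)).
  by rewrite -[h a b *n x]h1 -[x *n h a b]h2; split; zmod.
exists g.
  split=> [a|b] r x y; rewrite /g -proj_lin scalerBr; congr proj.
    by rewrite h'_linr h0_linr; zmod.
  by rewrite (h'_linl b) (h0_linl b); zmod.
move=> a b c; rewrite /obs_cocycle /hoch_d2 !gE.
rewrite (linB iota_lin) (linD iota_lin) (linB iota_lin).
rewrite (mul a _).1 (mul c _).2 !(nua_mulDr, nua_mulDl) mul_iotal mul_iotar !addr0.
have u_lin := bimul_lin1 (mu_bimul a); have v_lin := bimul_lin2 (mu_bimul c).
rewrite (linD u_lin) (linD v_lin) (mu_iota _ _).1 (mu_iota _ _).2 /h0.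
rewrite (linB u_lin) (linB v_lin) !(linD u_lin) !(linD v_lin).
rewrite (linN (lin_mulr (l a))) (linN (lin_mull (l c))).
rewrite -!nua_mulA mu_comm (bimul1M _ _ (mu_bimul a)) (bimul2M _ _ (mu_bimul c)).
rewrite (bimulE _ _ (mu_bimul b)).
(* The double actions on [l c] and [l a] become single actions plus products with [h], which cancel
   the products [l] [h] and [h] [l] already present. *)
have /= /(canRL (subrK _))-> := (hE a b (l c)).1.
have /= /(canRL (subrK _))-> := (hE b c (l a)).2.
zmod.
Qed.

End ObstructionClass.

(** * The vector space of linear maps *)

Section LinearMaps.
Context {F : fieldType} (U V : lmodType F).

(** Classical reflection makes linearity a boolean predicate, so that the subtype inherits its
    module structure from the function space. *)
Definition linear_pred : {pred U -> V} := fun f => `[< lin f >].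

Lemma linear_submod_closed : submod_closed linear_pred.
Proof.
split=> [|r f g /asboolP f_lin /asboolP g_lin].
  by apply/asboolP => r x y; rewrite -[RHS]/(r *: 0 + 0) scaler0 addr0.
apply/asboolP => s x y; rewrite -[LHS]/(r *: f _ + g _) f_lin g_lin.
rewrite -[RHS]/(s *: (r *: f x + g x) + (r *: f y + g y)) !scalerDr !scalerA mulrC; zmod.
Qed.

HB.instance Definition _ :=
  GRing.isSubmodClosed.Build F (U -> V) linear_pred linear_submod_closed.

Record linmap := LinMap { linfun_of :> U -> V; linfun_ofP : linfun_of \in linear_pred }.

HB.instance Definition _ := [isSub for linfun_of].
HB.instance Definition _ := [Choice of linmap by <:].
HB.instance Definition _ := [SubChoice_isSubLmodule of linmap by <:].

Lemma linmap_lin (f : linmap) : lin f.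
Proof. exact/asboolP/linfun_ofP. Qed.

Lemma linmap_ext (f g : linmap) : f =1 g -> f = g.
Proof. by move=> fg; apply/val_inj/funext. Qed.

Lemma linmapDE (f g : linmap) x : (f + g) x = f x + g x.
Proof. by []. Qed.

Lemma linmapZE r (f : linmap) x : (r *: f) x = r *: f x.
Proof. by []. Qed.

Lemma linmapNE (f : linmap) x : (- f) x = - f x.
Proof. by []. Qed.

Lemma linmap0E x : (0 : linmap) x = 0.
Proof. by []. Qed.

Definition mk_linmap (f : U -> V) (f_lin : lin f) : linmap :=
  LinMap (asboolT f_lin : f \in linear_pred).

End LinearMaps.

(** * The algebra built from a bimodule and test vectors *)

Section Envelope.
(* N is the bimodule that carries the hindrance h; T is a space of test vectors on which
   right translations by A (tri) compose up to right multiplication (star) by h. *)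
Context {F : fieldType} {A : nualg F} {N : bimod A} {T : lmodType F}.
Variables (star : T -> N -> T) (tri : T -> A -> T) (h : A -> A -> N).
Hypothesis star_linl : forall n, lin (star^~ n).
Hypothesis star_linr : forall t, lin (star t).
Hypothesis tri_linl : forall a, lin (tri^~ a).
Hypothesis tri_linr : forall t, lin (tri t).
Hypothesis star_star : forall t n n', star (star t n) n' = 0.
Hypothesis star_tri : forall t a n, star (tri t a) n = star t (bm_l N a n).
Hypothesis tri_star : forall t n a, tri (star t n) a = star t (bm_r N n a).
Hypothesis h_bilin : bilin h.
Hypothesis tri_tri : forall t a b, tri (tri t a) b = tri t (a *n b) + star t (h a b).

(* The coordinate in F^o is along the left identity e. *)
Definition env_car : lmodType F := (N * (F^o * T))%type.

Definition env_mul (k k' : env_car) : env_car :=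
  (0, (k.2.1 * k'.2.1, k.2.1 *: k'.2.2 + star k.2.2 k'.1)).

Lemma env_eq (k k' : env_car) :
  k.1 = k'.1 -> k.2.1 = k'.2.1 -> k.2.2 = k'.2.2 -> k = k'.
Proof. by case: k => ? [? ?]; case: k' => ? [? ?] /= -> -> ->. Qed.

Lemma env_mulA : associative env_mul.
Proof.
move=> x y z; apply: env_eq => //=; first by rewrite mulrA.
rewrite (linD (star_linl _)) (linZ (star_linl _)) star_star (lin0 (star_linr _)).
by rewrite scalerDr scalerA addr0; zmod.
Qed.

Lemma env_mul_linr x : lin (env_mul x).
Proof.
move=> r y z; apply: env_eq => /=; first by rewrite scaler0 addr0.
  by rewrite mulrDr -scalerAr.
by rewrite star_linr !scalerDr !scalerA (mulrC r); zmod.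
Qed.

Lemma env_mul_linl y : lin (env_mul^~ y).
Proof.
move=> r x z; apply: env_eq => /=; first by rewrite scaler0 addr0.
  by rewrite mulrDl -scalerAl.
by rewrite (star_linl _ r) !scalerDr scalerDl scalerA; zmod.
Qed.

Definition envelope : nualg F :=
  NUAlg env_mulA (fun x y z => linD (env_mul_linl z) x y) (fun x => linD (env_mul_linr x))
        (fun r x y => linZ (env_mul_linl y) r x) (fun r x => linZ (env_mul_linr x) r).

(** Since N multiplies K to zero from the left, a hindrance with values in N is invisible to the
    left components, which can thus be multiplicative; only the right components, through [tri],
    feel it. *)
Definition env_law (a : A) : bimul envelope :=
  ((fun k : env_car => (bm_l N a k.1, 0) : env_car),
   (fun k : env_car => (bm_r N k.1 a, (0, tri k.2.2 a)) : env_car)).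

Definition env_hindrance (a b : A) : envelope := (h a b, 0).

(** On T and N, [star_tri] is the exchange law between the two components, and [tri_star] is the
    compatibility of the right one with products. *)
Lemma env_law_bimul a : is_bimul (env_law a).
Proof.
split; [|split] => [r x y|r x y|x y].
- by apply: env_eq => /=; rewrite ?bm_l_linM // ?scaler0 addr0.
- apply: env_eq => /=; rewrite ?(bm_r_linM _ r) //; first by rewrite scaler0 addr0.
  exact: tri_linl.
split; last split; apply: env_eq => //=;
  rewrite ?mulr0 ?mul0r ?scaler0 ?scale0r ?add0r ?addr0 ?star_tri //.
- exact: lin0 (bm_l_linM a).
- exact/esym/(lin0 (star_linl _)).
- exact: lin0 (bm_r_linM a).
by rewrite (linD (tri_linl _)) (linZ (tri_linl _)) tri_star.
Qed.

Lemma env_law_lin (r : F) a b k :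
  (env_law (r *: a + b)).1 k = r *: (env_law a).1 k + (env_law b).1 k /\
  (env_law (r *: a + b)).2 k = r *: (env_law a).2 k + (env_law b).2 k.
Proof.
split; apply: env_eq => /=; rewrite ?(bm_l_linA _ r) ?(bm_r_linA _ r) ?scaler0 ?addr0 //.
exact: tri_linr.
Qed.

Lemma env_law_comm a b k :
  (env_law a).1 ((env_law b).2 k) = (env_law b).2 ((env_law a).1 k).
Proof.
by apply: env_eq => //=; rewrite ?bm_lrA // (lin0 (tri_linl _)).
Qed.

Lemma env_law_mul1 a b k :
  (env_law (a *n b)).1 k = (env_law a).1 ((env_law b).1 k).
Proof. by apply: env_eq => //=; rewrite bm_lA. Qed.

Lemma env_hindranceP : is_hindrance env_law env_hindrance.
Proof.
have [h_linr h_linl] := h_bilin; split; first split=> [a|b] r x y.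
- by apply: env_eq => /=; rewrite ?h_linr // scaler0 addr0.
- by apply: env_eq => /=; rewrite ?(h_linl b) // scaler0 addr0.
move=> a b k; split; apply: env_eq; rewrite /= ?mulr0 ?mul0r ?subrr ?subr0 //.
- by rewrite bm_lA subrr.
- by rewrite scale0r (lin0 (star_linl _)) addr0.
- by rewrite bm_rA subrr.
by rewrite tri_tri scaler0; zmod.
Qed.

Lemma anni_envelope (k : envelope) :
  anni k <-> k.2 = 0 /\ forall t, star t k.1 = 0.
Proof.
case: k => n q; split=> [nq0 /= | [/= -> n0] x].
  have q0 : q = 0.
    (* Left multiplication by e returns the component in F e + T. *)
    have /(congr1 snd) := (nq0 ((0, (1, 0)) : env_car)).2.
    rewrite /= mul1r scale1r (lin0 (star_linl _)) addr0.
    by case: q {nq0} => ? ? /= [-> ->].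
  split=> // t; have /(congr1 (fun k : env_car => k.2.2)) := (nq0 ((0, (0, t)) : env_car)).2.
  by rewrite /= scale0r add0r.
split; apply: env_eq => //=; rewrite ?mul0r ?mulr0 ?scale0r ?scaler0 ?n0 ?addr0 //.
by rewrite (lin0 (star_linl _)) add0r.
Qed.

Lemma obs_cocycle_envelope a1 a2 a3 :
  obs_cocycle env_law env_hindrance a1 a2 a3 = ((hoch_d2 h a1 a2 a3, 0) : env_car).
Proof.
apply: env_eq => //=; first by rewrite ?subr0 ?addr0.
by rewrite (lin0 (tri_linl _)) !subr0 ?addr0.
Qed.

End Envelope.

(** * The coinduced bimodule and its test vectors *)

Section CoinducedExtension.
Context {F : fieldType} {A : nualg F} {M : bimod A} (c : A -> A -> A -> M).
Hypothesis c_cocycle : is_3cocycle c.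

Local Notation W := (linmap A M).

Lemma lact_lin a (f : W) : lin (fun x => bm_l M a (f x)).
Proof. by move=> r x y; rewrite (linmap_lin f r) (bm_l_linM a r). Qed.

Lemma ract_lin (f : W) a : lin (fun x => f (a *n x) - bm_r M (f a) x).
Proof.
move=> r x y; rewrite (lin_mulr a r) (linmap_lin f r) (bm_r_linA (f a) r).
by rewrite scalerBr; zmod.
Qed.

Lemma cocycle_lin a b : lin (fun x => - c a b x).
Proof. by case: c_cocycle => -[c_lin _] _ r x y; rewrite (c_lin a b r) scalerN; zmod. Qed.

Definition lact a f : W := mk_linmap (lact_lin a f).
(** For a map g on A^+ and f(x) = g(x) - g(1)x, this is the f that belongs to the translate x ->
    g(ax). *)
Definition ract f a : W := mk_linmap (ract_lin f a).
Definition cocycle_map a b : W := mk_linmap (cocycle_lin a b).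

Lemma lact_linA f : lin (lact^~ f).
Proof. by move=> r a b; apply: linmap_ext => x; exact: bm_l_linA. Qed.

Lemma lact_linM a : lin (lact a).
Proof. by move=> r f g; apply: linmap_ext => x; exact: bm_l_linM. Qed.

Lemma ract_linA f : lin (ract f).
Proof.
move=> r a b; apply: linmap_ext => x; rewrite linmapDE linmapZE /=.
rewrite (lin_mull x r) !(linmap_lin f r) (bm_r_linM x r) scalerBr; zmod.
Qed.

Lemma ract_linM a : lin (ract^~ a).
Proof.
move=> r f g; apply: linmap_ext => x.
change (r *: f (a *n x) + g (a *n x) - bm_r M (r *: f a + g a) x =
        r *: (f (a *n x) - bm_r M (f a) x) + (g (a *n x) - bm_r M (g a) x)).
rewrite (bm_r_linM x r) scalerBr; zmod.
Qed.

Lemma lact_mul a b f : lact (a *n b) f = lact a (lact b f).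
Proof. by apply: linmap_ext => x; exact: bm_lA. Qed.

Lemma ract_mul f a b : ract f (a *n b) = ract (ract f a) b.
Proof.
apply: linmap_ext => x /=.
by rewrite nua_mulA bm_rA (linB (bm_r_linM x)); zmod.
Qed.

Lemma lact_ract a f b : ract (lact a f) b = lact a (ract f b).
Proof. by apply: linmap_ext => x /=; rewrite (linB (bm_l_linM a)) bm_lrA. Qed.

Lemma cocycle_map_linl b : lin (cocycle_map^~ b).
Proof.
case: c_cocycle => -[_ [_ c_lin]] _ r x y; apply: linmap_ext => z.
by rewrite linmapDE linmapZE /= (c_lin b z r) scalerN; zmod.
Qed.

Lemma cocycle_map_linr a : lin (cocycle_map a).
Proof.
case: c_cocycle => -[_ [c_lin _]] _ r x y; apply: linmap_ext => z.
by rewrite linmapDE linmapZE /= (c_lin a z r) scalerN; zmod.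
Qed.

(** This is the cocycle identity of [c] with fourth argument [x], up to sign; the correction term of
    [ract] supplies the summand c(a1, a2, a3)x. *)
Lemma cocycle_mapP a1 a2 a3 :
  lact a1 (cocycle_map a2 a3) - cocycle_map (a1 *n a2) a3
    + cocycle_map a1 (a2 *n a3) - ract (cocycle_map a1 a2) a3 = 0.
Proof.
apply: linmap_ext => x; rewrite !(linmapDE, linmapNE) linmap0E /=.
have := c_cocycle.2 a1 a2 a3 x; rewrite /hoch_d3 => dc.
rewrite (linN (bm_l_linM a1)) (linN (bm_r_linM x)) -[RHS]oppr0 -dc; zmod.
Qed.

(* The pair (m, f) stands for the map on A^+ sending 1 to m and x in A to f x + m x. *)
Definition coind_car : lmodType F := (M * W)%type.
Definition coind_l (a : A) (n : coind_car) : coind_car := (bm_l M a n.1, lact a n.2).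
Definition coind_r (n : coind_car) (a : A) : coind_car :=
  (bm_r M n.1 a + n.2 a, ract n.2 a).

Lemma pair_eq (U V : Type) (p q : U * V) : p.1 = q.1 -> p.2 = q.2 -> p = q.
Proof. by case: p q => ? ? [? ?] /= -> ->. Qed.

Lemma coind_l_linA n : lin (coind_l^~ n).
Proof. by move=> r a b; apply: pair_eq; [exact: bm_l_linA | exact: lact_linA]. Qed.

Lemma coind_l_linM a : lin (coind_l a).
Proof. by move=> r x y; apply: pair_eq; [exact: bm_l_linM | exact: lact_linM]. Qed.

Lemma coind_r_linA n : lin (coind_r n).
Proof.
move=> r a b; apply: pair_eq; last exact: ract_linA.
by rewrite /= (bm_r_linA _ r) (linmap_lin n.2 r) scalerDr; zmod.
Qed.

Lemma coind_r_linM a : lin (coind_r^~ a).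
Proof.
move=> r x y; apply: pair_eq; last exact: ract_linM.
change (bm_r M (r *: x.1 + y.1) a + (r *: x.2 a + y.2 a) =
        r *: (bm_r M x.1 a + x.2 a) + (bm_r M y.1 a + y.2 a)).
by rewrite (bm_r_linM a r) scalerDr; zmod.
Qed.

Lemma coind_lA a b n : coind_l (a *n b) n = coind_l a (coind_l b n).
Proof. by apply: pair_eq; [exact: bm_lA | exact: lact_mul]. Qed.

Lemma coind_rA a b n : coind_r n (a *n b) = coind_r (coind_r n a) b.
Proof.
apply: pair_eq; last exact: ract_mul.
by rewrite /= bm_rA (linD (bm_r_linM b)); zmod.
Qed.

Lemma coind_lrA a b n : coind_r (coind_l a n) b = coind_l a (coind_r n b).
Proof.
apply: pair_eq; last exact: lact_ract.
by rewrite /= bm_lrA (linD (bm_l_linM a)).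
Qed.

Definition coind : bimod A :=
  BiMod coind_l_linA coind_l_linM coind_r_linA coind_r_linM coind_lA coind_rA coind_lrA.

Definition coind_cochain (a b : A) : coind := (0, cocycle_map a b) : coind_car.

Lemma coind_cochain_bilin : bilin coind_cochain.
Proof.
split=> [a|b] r x y; apply: pair_eq; rewrite /= ?scaler0 ?addr0 //.
  exact: cocycle_map_linr.
exact: cocycle_map_linl.
Qed.

(** The component in M comes only from the evaluation [n.2 a] in [coind_r]; the sign in
    [cocycle_map] cancels the one in [hoch_d2]. *)
Lemma coind_cochain_d2 a1 a2 a3 :
  hoch_d2 coind_cochain a1 a2 a3 = ((c a1 a2 a3, 0) : coind_car).
Proof.
apply: pair_eq; last exact: cocycle_mapP.
by rewrite /= (lin0 (bm_l_linM a1)) (lin0 (bm_r_linM a3)); zmod.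
Qed.

(* The right module E^+ over the extension E of A by W with cocycle cocycle_map. *)
Definition test_car : lmodType F := (F^o * (A * W))%type.

Definition test_star (t : test_car) (n : coind) : test_car :=
  let n2 := (n : coind_car).2 in (0, (0, t.1 *: n2 + lact t.2.1 n2)).

Definition test_act (t : test_car) (b : A) : test_car :=
  (0, (t.1 *: b + t.2.1 *n b, ract t.2.2 b + cocycle_map t.2.1 b)).

Lemma test_eq (s t : test_car) : s.1 = t.1 -> s.2.1 = t.2.1 -> s.2.2 = t.2.2 -> s = t.
Proof. by case: s => ? [? ?]; case: t => ? [? ?] /= -> -> ->. Qed.

Lemma test_star_linl n : lin (test_star^~ n).
Proof.
move=> r s t; apply: test_eq; rewrite /= ?scaler0 ?addr0 //.
by rewrite (lact_linA _ r) scalerDl scalerDr scalerA; zmod.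
Qed.

Lemma test_star_linr t : lin (test_star t).
Proof.
move=> r x y; apply: test_eq; rewrite /= ?scaler0 ?addr0 //.
by rewrite (lact_linM _ r) !scalerDr !scalerA (mulrC r); zmod.
Qed.

Lemma test_act_linl b : lin (test_act^~ b).
Proof.
move=> r s t; apply: test_eq; rewrite /= ?scaler0 ?addr0 //.
  by rewrite (lin_mull b r) scalerDl scalerDr scalerA; zmod.
by rewrite (ract_linM b r) (cocycle_map_linl b r) scalerDr; zmod.
Qed.

Lemma test_act_linr t : lin (test_act t).
Proof.
move=> r a b; apply: test_eq; rewrite /= ?scaler0 ?addr0 //.
  by rewrite (lin_mulr _ r) !scalerDr !scalerA (mulrC r); zmod.
by rewrite (ract_linA _ r) (cocycle_map_linr _ r) scalerDr; zmod.
Qed.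

Lemma test_star_star t n n' : test_star (test_star t n) n' = 0.
Proof.
by apply: test_eq; rewrite //= scale0r (lin0 (lact_linA _)) addr0.
Qed.

Lemma test_star_act t a n : test_star (test_act t a) n = test_star t (bm_l coind a n).
Proof.
apply: test_eq; rewrite //= scale0r (linD (lact_linA _)) (linZ (lact_linA _)) lact_mul.
by rewrite add0r.
Qed.

Lemma test_act_star t n a : test_act (test_star t n) a = test_star t (bm_r coind n a).
Proof.
apply: test_eq; rewrite //= ?scale0r ?(lin0 (lin_mull a)) ?addr0 //.
rewrite (linD (ract_linM a)) (linZ (ract_linM a)) lact_ract.
by rewrite (lin0 (cocycle_map_linl a)) addr0.
Qed.

(** Associativity in E^+: the product of a and b in E is ab plus [cocycle_map a b], and [test_star]
    multiplies by elements of W. *)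
Lemma test_act_act t a b :
  test_act (test_act t a) b = test_act t (a *n b) + test_star t (coind_cochain a b).
Proof.
apply: test_eq; rewrite /= ?addr0 //.
  by rewrite scale0r nua_mulDl nua_mulZl nua_mulA; zmod.
rewrite (linD (ract_linM b)) -ract_mul (linD (cocycle_map_linl b)) (linZ (cocycle_map_linl b)).
have := cocycle_mapP t.2.1 a b; set r := ract (cocycle_map _ _) _ => /eqP.
by rewrite subr_eq0 => /eqP <-; zmod.
Qed.

Lemma test_star_eq0 (n : coind) : (forall t, test_star t n = 0) <-> (n : coind_car).2 = 0.
Proof.
split=> [n0 | n2 t]; last first.
  by apply: test_eq; rewrite //= n2 scaler0 (lin0 (lact_linM _)) addr0.
(* The unit of E^+ recovers the component of [n] in W. *)
have /(congr1 (fun t : test_car => t.2.2)) := n0 ((1, 0) : test_car).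
by rewrite /= scale1r (lin0 (lact_linA _)) addr0.
Qed.

End CoinducedExtension.

(** * Assembly of the algebra and comparison of its laws *)

Theorem theorem1 (F : fieldType) (A : nualg F) (M : bimod A)
    (c : A -> A -> A -> M) (hc : is_3cocycle c) :
  exists (K : nualg F) (iota : M -> K) (xi : A -> out K),
    (* K contains M as a subspace, with Anni K = M *)
    lin iota /\ injective iota /\
    (forall k : K, anni k <-> exists m, k = iota m) /\
    (* xi is a coupling *)
    is_coupling xi /\
    (* xi admits a bimultiplication law mu = (u,v) with a |-> u_a an algebra hom A -> End(K) *)
    (exists mu, is_bimul_law xi mu /\
       forall a b k, (mu (a *n b)).1 k = (mu a).1 ((mu b).1 k)) /\
    (forall mu, is_bimul_law xi mu ->
       (* (2) induced bimodule structure on Anni K = M is the given one *)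
       (forall a m, (mu a).1 (iota m) = iota (bm_l M a m) /\
                    (mu a).2 (iota m) = iota (bm_r M m a)) /\
       (* (3) Obs(xi) = [c] in HH^3(A,M) *)
       (forall h, is_hindrance mu h ->
          exists g : A -> A -> M, bilin g /\
            forall a1 a2 a3, obs_cocycle mu h a1 a2 a3 = iota (c a1 a2 a3 + hoch_d2 g a1 a2 a3))).
Proof.
pose sl := @test_star_linl F A M; pose sr := @test_star_linr F A M.
pose ss := @test_star_star F A M; pose K := envelope sl sr ss.
pose iota m : K := (((m, 0) : coind_car), 0).
pose proj (k : K) : M := (k.1 : coind_car).1.
pose mu : A -> bimul K := env_law (test_act hc) sl sr ss.
pose h : A -> A -> K := env_hindrance (coind_cochain hc) sl sr ss.
have iota_lin : lin iota.
  by move=> r x y; apply: env_eq; rewrite /= ?scaler0 ?addr0 //; apply: pair_eq;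
    rewrite /= ?scaler0 ?addr0.
have proj_lin : lin proj by [].
have projK : cancel iota proj by [].
have anniP (k : K) : anni k <-> exists m, k = iota m.
  (* The annihilator is the kernel of the projection from N to W. *)
  rewrite anni_envelope test_star_eq0; split=> [[k2 k12]|[m ->]] //.
  by exists (proj k); apply: pair_eq => //; apply: pair_eq.
have mu_bimul a : is_bimul (mu a).
  exact: env_law_bimul sl sr (test_act_linl hc) ss (test_star_act hc) (test_act_star hc) a.
have mu_lin (r : F) a b k := env_law_lin (test_act_linr hc) r a b (k : K).
have mu_comm a b k := env_law_comm (test_act_linl hc) a b (k : K).
have h_hindrance : is_hindrance mu h.
  exact: env_hindranceP sl sr ss (coind_cochain_bilin hc) (test_act_act hc).
have mu_iota a m : (mu a).1 (iota m) = iota (bm_l M a m) /\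
                   (mu a).2 (iota m) = iota (bm_r M m a).
  split; apply: env_eq => //; first apply: pair_eq => //=.
  - exact: lin0 (lact_linM a).
  - apply: pair_eq; first exact: addr0.
    exact: lin0 (ract_linM a).
  exact: lin0 (test_act_linl hc a).
exists K, iota, (fun a => natural (mu a)); split; first exact: iota_lin.
split; first exact: can_inj projK.
split; first exact: anniP.
split; first exact: coupling_natural mu_bimul mu_lin h_hindrance.
split.
  exists mu; split; last exact: env_law_mul1.
  by split; [exact: mu_bimul | split; [exact: mu_lin | split]].
move=> mu' law'; split; first exact: (law_iota iota_lin proj_lin projK anniP mu_lin mu_iota law').
move=> h' h'_hindrance.
have [g g_bilin obsE] := obs_cocycle_law iota_lin proj_lin projK anniP mu_bimul mu_lin
  mu_comm mu_iota h_hindrance law' h'_hindrance.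
exists g; split=> [|a1 a2 a3]; first exact: g_bilin.
rewrite obsE (linD iota_lin); congr (_ + _).
(* For the reference law the cocycle is the coboundary of [coind_cochain] in N, which is [c] on the
   nose. *)
rewrite (obs_cocycle_envelope _ sl sr (test_act_linl hc) ss).
by rewrite coind_cochain_d2.
Qed.
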